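(* Let $G_1,G_2,\ldots,G_n$ ($n\ge 1$) be a finite sequence of pairwise disjoint connected graphs and let $x_i\in V(G_i)$ for $i=1,\ldots,n$. Let $B(G_1,\ldots,G_n)$ be the bouquet of the graphs $\{G_i\}_{i=1}^n$ with respect to the vertices $\{x_i\}_{i=1}^n$, i.e. the graph obtained from the disjoint union of $G_1,\ldots,G_n$ by identifying all the vertices $x_1,\ldots,x_n$ to a single vertex. Then $$\left(\sum_{i=1}^{n}\gamma_{sp}(G_i)\right)-n+1\leq \gamma_{sp}(B(G_1,\ldots,G_n))\leq \sum_{i=1}^{n}\gamma_{sp}(G_i).$$
   Context: All graphs are finite, simple and undirected. $N(v)$ denotes the open neighbourhood of $v$. For a graph $G=(V,E)$ and $S\subseteq V$ write $\overline{S}=V\setminus S$. A set $S\subseteq V$ is dominating if every vertex of $\overline{S}$ is adjacent to at least one vertex of $S$. A dominating set $S$ is a super dominating set of $G$ if for every $u\in\overline{S}$ there exists $w\in S$ with $N(w)\cap\overline{S}=\{u\}$. The super domination number $\gamma_{sp}(G)$ is the minimum cardinality of a super dominating set of $G$. *)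

(* Defs.v *)
From mathcomp Require Import all_boot.

Set Implicit Arguments.
Unset Strict Implicit.
Unset Printing Implicit Defensive.

Record sgraph := SGraph {
  vertex :> finType;
  adj : rel vertex;
  adj_sym : symmetric adj;
  adj_irrefl : irreflexive adj
}.

Definition connected_graph (G : sgraph) : Prop :=
  forall u v : G, connect (@adj G) u v.

Section SuperDomination.

Variable G : sgraph.

Definition open_nbh (v : G) : {set G} := [set w | adj v w].

Definition dominating (S : {set G}) : bool :=
  [forall v in ~: S, exists w in S, adj v w].

Definition super_dominating (S : {set G}) : bool :=
  dominating S &&
  [forall u in ~: S, exists w in S, open_nbh w :&: ~: S == [set u]].

Lemma super_dominatingT : super_dominating [set: G].
Proof.
by rewrite /super_dominating /dominating setCT; apply/andP; split;
   apply/forallP => u; rewrite inE.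
Qed.

(* The minimum ranges over a nonempty family, by super_dominatingT, so the
   default value [set: G] does not affect it: see gamma_spP. *)
Definition gamma_sp : nat :=
  #|[arg min_(S < [set: G] | super_dominating S) #|S|]|.

Lemma gamma_spP :
  (exists2 S : {set G}, super_dominating S & #|S| = gamma_sp) /\
  (forall S : {set G}, super_dominating S -> gamma_sp <= #|S|).
Proof.
rewrite /gamma_sp; case: arg_minnP => [|S Ssd Smin].
  exact: super_dominatingT.
by split; [exists S | move=> S' /Smin].
Qed.

End SuperDomination.

Section DisjointUnion.

Variables (n : nat) (G : 'I_n -> sgraph).

Definition dunion_adj : rel {i : 'I_n & G i} :=
  fun p q => (tag p == tag q) && adj (tagged p) (tagged_as p q).

Lemma dunion_adj_sym : symmetric dunion_adj.
Proof.
move=> [i a] [j b]; rewrite /dunion_adj /=.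
have [ij|ij] := eqVneq i j; last by [].
by subst j; rewrite !tagged_asE adj_sym.
Qed.

Lemma dunion_adj_irrefl : irreflexive dunion_adj.
Proof. by case=> i a; rewrite /dunion_adj /= tagged_asE adj_irrefl andbF. Qed.

Definition dunion : sgraph := SGraph dunion_adj_sym dunion_adj_irrefl.

End DisjointUnion.

Section Bouquet.

Variables (n : nat) (G : 'I_n -> sgraph) (x : forall i, G i).

Definition is_root (p : dunion G) : bool := tagged p == x (tag p).

(* None is the vertex obtained by identifying all the roots x i; the other
   vertices are those of the disjoint union that are not roots. When n = 0 there
   is no root and None is spurious. *)
Definition bouquet_vertex : finType := option {p : dunion G | ~~ is_root p}.

(* The identification map: every root goes to None, every other p to Some p. *)
Definition bouquet_proj (p : dunion G) : bouquet_vertex := insub p.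

Definition bouquet_adj : rel bouquet_vertex :=
  fun u v => [exists p, exists q,
    [&& bouquet_proj p == u, bouquet_proj q == v & adj p q]].

Lemma bouquet_adj_sym : symmetric bouquet_adj.
Proof.
suff sub u v : bouquet_adj u v -> bouquet_adj v u.
  by move=> u v; apply/idP/idP; apply: sub.
move=> /existsP[p /existsP[q /and3P[pu qv pq]]].
by apply/existsP; exists q; apply/existsP; exists p; rewrite pu qv adj_sym.
Qed.

Lemma bouquet_adj_irrefl : irreflexive bouquet_adj.
Proof.
move=> u; apply: negbTE; apply/negP => /existsP[p /existsP[q]].
move=> /and3P[/eqP pu /eqP qu pq].
have /eqP tpq : tag p == tag q by case/andP: pq.
suff epq : p = q by rewrite epq adj_irrefl in pq.
move: pu; rewrite -qu /bouquet_proj.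
case: insubP => [a _ ap|]; case: insubP => [b _ bq|] //.
  by case=> ab; rewrite -ap -bq ab.
rewrite /is_root !negbK; case: p q tpq {pq qu} => [i a] [j b] /= ij.
by subst j => /eqP -> /eqP ->.
Qed.

Definition bouquet : sgraph := SGraph bouquet_adj_sym bouquet_adj_irrefl.

End Bouquet.

(* Main.v *)
(** Lower bound: cut a super dominating set D of the bouquet into its traces
    D_i on the G_i, adding the root x_i to D_i when the root is not in D, except
    in the one graph G_j containing a vertex that super dominates the root. Each
    trace is super dominating and the root is counted at most n - 1 times too
    often.

    Upper bound: a super dominating set S comes with an injection f from its
    complement to S such that the edges between the complement of S and the image
    of f are exactly the pairs (u, f u). This is symmetric, so the complement of
    the image of f is super dominating too, with the same cardinality: hence
    each G_i has a minimum super dominating set S_i containing x_i. Gluing them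
    saves n - 1 vertices. The only vertices that may fail to be super dominated
    in the union are the u_i such that x_i is adjacent to a single vertex u_i
    outside S_i; adding all of them but one costs at most n - 1, and the last one
    either does not exist or is super dominated by the root. *)

Require Import Defs.
From mathcomp Require Import all_boot all_order all_algebra.
From mathcomp Require Import zify.

Set Implicit Arguments.
Unset Strict Implicit.
Unset Printing Implicit Defensive.

Import Order.TTheory GRing.Theory Num.Theory.

(** Domination drops out: a vertex of [S] whose only neighbour outside [S] is [u] already dominates
    [u]. *)
Lemma super_dominatingP (G : sgraph) (S : {set G}) :
  reflect (forall u, u \notin S -> exists w,
             [/\ w \in S, adj w u & forall v, v \notin S -> adj w v -> v = u])
          (super_dominating S).
Proof.
apply: (iffP andP) => [[_ /forall_inP sdS] u uS|sdS].
  have /exists_inP[w wS /eqP Nw] : [exists w in S, open_nbh w :&: ~: S == [set u]].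
    by apply: sdS; rewrite inE.
  exists w; split=> // [|v vS wv].
    by have := set11 u; rewrite -Nw !inE => /andP[].
  by apply/set1P; rewrite -Nw !inE wv.
split; apply/forall_inP => u; rewrite inE => uS;
  have [w [wS wu wv]] := sdS u uS; apply/exists_inP; exists w => //.
  by rewrite adj_sym.
apply/eqP/setP => v; rewrite !inE.
by apply/andP/eqP => [[wv' vS]|->//]; apply: wv.
Qed.

Lemma super_dominating_mem (G : sgraph) (S : {set G}) (x : G) :
  super_dominating S ->
  exists S' : {set G}, [/\ super_dominating S', #|S'| = #|S| & x \in S'].
Proof.
move=> sdS; case xS: (x \in S); first by exists S.
have /super_dominatingP sdSP := sdS.
pose dom u w := [&& w \in S, adj w u & [forall v, (v \notin S) ==> adj w v ==> (v == u)]].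
have domP u : u \notin S -> exists w, dom u w.
  move=> /sdSP[w [wS wu wv]]; exists w; rewrite /dom wS wu /=.
  by apply/forallP => v; apply/implyP => vS; apply/implyP => /(wv v vS) ->.
pose f u := odflt u [pick w | dom u w].
have fP u : u \notin S -> dom u (f u).
  move=> /domP[w uw]; rewrite /f; case: pickP => //= no.
  by rewrite no in uw.
have f_uniq u v : u \notin S -> v \notin S -> adj (f u) v -> v = u.
  move=> /fP/and3P[_ _ /forallP/(_ v)] /implyP fu vS fuv.
  by move: (fu vS); rewrite fuv => /eqP.
have f_adj u : u \notin S -> adj (f u) u by move=> /fP/and3P[].
have f_S u : u \notin S -> f u \in S by move=> /fP/and3P[].
have f_inj : {in ~: S &, injective f}.
  move=> u v; rewrite !inE => uS vS fuv; apply/esym/f_uniq => //.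
  by rewrite fuv f_adj.
have notin_img v : v \notin S -> v \notin f @: ~: S.
  by apply: contraNN => /imsetP[u]; rewrite inE => uS ->; apply: f_S.
(* The roles of [u] and [f u] are exchanged: [u] super dominates [f u], as adjacency of [u] to
   [f u'] forces [u' = u]. The new set contains [x] because [f] takes its values in [S]. *)
exists (~: (f @: ~: S)); split.
- apply/super_dominatingP => w; rewrite inE negbK => /imsetP[u].
  rewrite inE => uS ->; exists u; split; first by rewrite inE notin_img.
    by rewrite adj_sym f_adj.
  move=> v; rewrite inE negbK => /imsetP[u']; rewrite inE => u'S ->.
  by rewrite adj_sym => /f_uniq -> .
- by apply/eqP; rewrite -(eqn_add2l #|f @: ~: S|) cardsC (card_in_imset f_inj)
    addnC cardsC.
- by rewrite inE notin_img ?xS.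
Qed.

Lemma sum_eq1 (I : finType) (j : I) : \sum_i (i == j) = 1.
Proof. by rewrite (bigD1 j) //= eqxx big1 // => i /negPf ->. Qed.

(** * Vertices and edges of the bouquet as images under gluing *)

Section BouquetProjection.

Variables (n : nat) (G : 'I_n -> sgraph) (x : forall i, G i).
Implicit Types (i j : 'I_n) (D : {set bouquet x}).

Definition glue i (a : G i) : bouquet x := @bouquet_proj n G x (Tagged G a).
Arguments glue : clear implicits.

Notation root := (None : bouquet x).

Lemma glue_root i : glue i (x i) = root.
Proof. by rewrite /glue /bouquet_proj insubF // /is_root /= eqxx. Qed.

Lemma bouquet_projK (p : dunion G) :
  ~~ is_root x p -> omap val (bouquet_proj x p) = Some p.
Proof. by move=> px; rewrite /bouquet_proj insubT. Qed.

Lemma glue_eq_root i a : (glue i a == root) = (a == x i).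
Proof.
apply/eqP/eqP => [|->]; last exact: glue_root.
have [//|ax] := eqVneq a (x i).
by have := @bouquet_projK (Tagged G a) ax; rewrite -/(glue i a) => /[swap] ->.
Qed.

(** The conclusion lives in the disjoint union because [a] and [b] have different types until
    [i = j] is known. *)
Lemma glue_inj_tagged i j a b :
  a != x i -> glue i a = glue j b -> Tagged G a = Tagged G b.
Proof.
move=> ax ab; have bx : b != x j by rewrite -glue_eq_root -ab glue_eq_root.
apply/Some_inj; rewrite -(@bouquet_projK (Tagged G a)) //.
by rewrite -(@bouquet_projK (Tagged G b)) //; congr omap.
Qed.

Lemma glue_inj i : injective (glue i).
Proof.
move=> a b ab; have [ax|ax] := eqVneq a (x i).
  by apply/esym/eqP; rewrite ax -glue_eq_root -ab ax glue_root.
by have /eqP := glue_inj_tagged ax ab; rewrite eq_Tagged => /eqP.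
Qed.

Lemma glue_surj (b : bouquet x) :
  b != root -> exists i, exists2 a, a != x i & b = glue i a.
Proof.
case: b => // -[[i a] ax] _; exists i, a => //.
by rewrite /glue /bouquet_proj insubT.
Qed.

Lemma bouquet_adjP (b c : bouquet x) :
  reflect (exists i (a a' : G i), [/\ b = glue i a, c = glue i a' & adj a a'])
          (adj b c).
Proof.
apply: (iffP existsP) => [[[i a] /existsP[[j a']]]|[i [a [a' [-> -> aa']]]]].
  case/and3P=> /eqP <- /eqP <- /andP[/= /eqP ij]; subst j.
  by rewrite tagged_asE => aa'; exists i, a, a'.
exists (Tagged G a); apply/existsP; exists (Tagged G a').
by rewrite !eqxx /= /dunion_adj /= eqxx tagged_asE.
Qed.

Lemma adj_glue_nonroot i a (c : bouquet x) :
  a != x i -> adj (glue i a) c -> exists2 a', c = glue i a' & adj a a'.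
Proof.
move=> ax /bouquet_adjP[j [b [b' [ab -> bb']]]].
have E := glue_inj_tagged ax ab; have ij : i = j := congr1 tag E; subst j.
by move/eqP: E; rewrite eq_Tagged /= => /eqP ->; exists b'.
Qed.

Lemma adj_glue_root (c : bouquet x) :
  adj root c -> exists i, exists2 a, c = glue i a & adj (x i) a.
Proof.
move=> /bouquet_adjP[i [a [a' [/esym/eqP]]]].
by rewrite glue_eq_root => /eqP -> -> xa; exists i, a'.
Qed.

(** An edge has an end other than the root, and that end determines the graph the edge comes
    from. *)
Lemma adj_glue i a a' : adj (glue i a) (glue i a') = adj a a'.
Proof.
apply/idP/idP => [|aa']; last by apply/bouquet_adjP; exists i, a, a'.
have [->|ax] := eqVneq a (x i); last first.
  by case/(adj_glue_nonroot ax) => b /glue_inj <-.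
have [->|ax'] := eqVneq a' (x i); first by rewrite adj_irrefl.
rewrite adj_sym => /(adj_glue_nonroot ax')[b /glue_inj <-].
by rewrite adj_sym.
Qed.

(** The traces of [D] on the graphs overlap only in the root, so without it their cardinalities add
    up. *)
Lemma card_glue D :
  #|D :\ root| = \sum_(i < n) #|(glue i @^-1: D) :\ x i|.
Proof.
pose A := [set p : dunion G | ~~ is_root x p & bouquet_proj x p \in D].
have -> : D :\ root = bouquet_proj x @: A.
  apply/setP => b; apply/setD1P/imsetP => [[b0 bD]|[p]].
    have [i [a ax ba]] := glue_surj b0.
    by exists (Tagged G a); rewrite // inE /is_root ax -[bouquet_proj _ _]ba.
  by rewrite inE => /andP[px pD] ->; split=> //; rewrite /bouquet_proj insubT.
rewrite card_in_imset => [|p q]; last first.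
  rewrite !inE => /andP[px _] /andP[qx _] pq.
  by apply/Some_inj; rewrite -!bouquet_projK // pq.
rewrite -sum1_card; under [RHS]eq_bigr do rewrite -sum1_card.
rewrite (@sig_big_dep _ _ _ _ (fun i => G i : finType) xpredT
          (fun i a => a \in (glue i @^-1: D) :\ x i) (fun _ _ => 1)).
by apply: eq_bigl => -[i a]; rewrite !inE.
Qed.

(** * Lower bound: traces of a super dominating set *)

Lemma trace_super_dominated D i (u : G i) :
  super_dominating D -> u != x i -> u \notin glue i @^-1: D ->
  exists w, [/\ w \in glue i @^-1: D, adj w u &
              forall v, v \notin glue i @^-1: D -> adj w v -> v = u].
Proof.
move=> /super_dominatingP sdD ux; rewrite inE => /sdD[b [bD bu b_uniq]].
(* As [u] is not a root, its super dominating vertex lies in the same graph. *)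
have [w bw uw] : exists2 w, b = glue i w & adj u w.
  by apply: adj_glue_nonroot => //; rewrite adj_sym.
subst b; exists w; split; rewrite ?inE 1?adj_sym // => v; rewrite inE => vD wv.
by apply/(@glue_inj i)/b_uniq; rewrite ?adj_glue.
Qed.

Lemma sum_gamma_le_bouquet D :
  super_dominating D -> \sum_(i < n) gamma_sp (G i) + 1 <= #|D| + n.
Proof.
move=> sdD; pose T i := glue i @^-1: D.
have gammaU i : gamma_sp (G i) <= #|T i :\ x i| + 1.
  have -> : #|T i :\ x i| + 1 = #|x i |: T i|.
    rewrite [RHS](cardsD1 (x i)) setU11 addnC; congr (_ + _).
    by apply: eq_card => u; rewrite !inE; case: eqP.
  have [_] := gamma_spP (G i); apply; apply/super_dominatingP => u.
  rewrite !inE negb_or => /andP[ux uT].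
  have [|w [wT wu w_uniq]] := trace_super_dominated sdD ux; first by rewrite inE.
  exists w; split=> //; first by rewrite setU1r.
  by move=> v; rewrite in_setU1 negb_or => /andP[_]; apply: w_uniq.
have -> : #|D| = (root \in D) + \sum_(i < n) #|T i :\ x i|.
  by rewrite (cardsD1 root) card_glue.
have [rD|rD] := boolP (root \in D).
  have := leq_sum (index_enum _) (fun i (_ : true) => gammaU i).
  by rewrite big_split /= sum1_card card_ord; lia.
have /super_dominatingP/(_ _ rD)[b [bD br b_uniq]] := sdD.
have [j [w bw xw]] : exists j, exists2 w, b = glue j w & adj (x j) w.
  by apply: adj_glue_root; rewrite adj_sym.
have gamma_j : gamma_sp (G j) <= #|T j :\ x j|.
  have xT : x j \notin T j by rewrite inE glue_root.
  have -> : T j :\ x j = T j by apply/setDidPl; rewrite disjoint_sym disjoints1.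
  have [_] := gamma_spP (G j); apply; apply/super_dominatingP => u uT.
  have [->|ux] := eqVneq u (x j); last exact: trace_super_dominated.
  exists w; rewrite inE -bw adj_sym; split=> // v; rewrite inE => vD wv.
  by apply/(@glue_inj j); rewrite glue_root; apply: b_uniq; rewrite ?bw ?adj_glue.
(* The unit saved at [j] makes up for the root not being counted in [D]. *)
have le_i i : gamma_sp (G i) + (i == j) <= #|T i :\ x i| + 1.
  by have [->|_] := eqVneq i j; rewrite ?leq_add2r ?addn0.
have := leq_sum (index_enum _) (fun i (_ : true) => le_i i).
by rewrite !big_split /= sum_eq1 sum1_card card_ord; lia.
Qed.

(** * Upper bound: gluing super dominating sets that contain the roots *)

Lemma bouquet_le_sum_gamma :
  0 < n -> gamma_sp (bouquet x) <= \sum_(i < n) gamma_sp (G i).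
Proof.
move=> n_gt0.
have /fin_all_exists[S S_spec] i : exists S : {set G i},
    [/\ super_dominating S, #|S| = gamma_sp (G i) & x i \in S].
  have [[S /(super_dominating_mem (x i))[S' [sdS' cardS' xS']] cardS] _] :=
    gamma_spP (G i).
  by exists S'; rewrite cardS'.
have sdS i : super_dominating (S i) by case: (S_spec i).
have xS i : x i \in S i by case: (S_spec i).
pose U i := open_nbh (x i) :\: S i.
(* [i0] is the graph left unenlarged. It is chosen with [U i0] not a singleton whenever possible, so
   that a singleton [U i0] forces all the [U i] to be singletons. *)
have [i0 i0P] : exists i0, (#|U i0| == 1) ==> [forall i, #|U i| == 1].
  have [allU|/forallPn[i0 /negPf Ui0]] := boolP [forall i, #|U i| == 1].
    by exists (Ordinal n_gt0); apply/implyP.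
  by exists i0; rewrite Ui0.
pose T i := if (i != i0) && (#|U i| == 1) then S i :|: U i else S i.
have ST i : S i \subset T i by rewrite /T; case: ifP => // _; apply: subsetUl.
have xT i : x i \in T i := subsetP (ST i) _ (xS i).
have cardT i : #|T i| <= #|S i| + (i != i0).
  rewrite /T; case: ifP => [/andP[-> /eqP U1]|_]; last exact: leq_addr.
  by rewrite (leq_trans (leq_card_setU _ _)) // U1.
pose D : {set bouquet x} := [set b | [exists i, b \in glue i @: T i]].
have DT i : glue i @^-1: D = T i.
  apply/setP => a; rewrite !inE; apply/existsP/idP => [[j /imsetP[b bT ab]]|aT].
    have [->//|ax] := eqVneq a (x i).
    have E := glue_inj_tagged ax ab; have ij : i = j := congr1 tag E; subst j.
    by move/eqP: E; rewrite eq_Tagged /= => /eqP ->.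
  by exists i; apply: imset_f.
have glueD i a : (glue i a \in D) = (a \in T i) by rewrite -DT [RHS]in_set.
have rootD : root \in D by rewrite -(glue_root i0) glueD xT.
have cardD : #|D| <= \sum_(i < n) gamma_sp (G i).
  rewrite (cardsD1 root) rootD card_glue.
  have -> : \sum_(i < n) gamma_sp (G i) = \sum_(i < n) #|S i|.
    by apply: eq_bigr => i _; case: (S_spec i).
  (* Removing the root pays for the vertex that [T i] may gain; at [i0] nothing is gained, and the
     spare unit pays for the root of [D]. *)
  have le_i i : #|(glue i @^-1: D) :\ x i| + (i == i0) <= #|S i|.
    by rewrite DT; have := cardT i; rewrite (cardsD1 (x i)) xT; case: eqP; lia.
  have := leq_sum (index_enum _) (fun i (_ : true) => le_i i).
  by rewrite big_split /= sum_eq1; lia.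
apply: leq_trans cardD; have [_] := gamma_spP (bouquet x); apply.
apply/super_dominatingP => b bD.
have [|i [u ux bu]] := @glue_surj b; first by apply: contraNneq bD => ->.
subst b; rewrite glueD in bD.
have uS : u \notin S i := contra (subsetP (ST i) u) bD.
have /super_dominatingP/(_ u uS)[w [wS wu w_uniq]] := sdS i.
exists (glue i w); rewrite glueD adj_glue (subsetP (ST i)) //; split=> // c cD.
have [wx|wx] := eqVneq w (x i); last first.
  move=> /(adj_glue_nonroot wx)[v cv wv]; subst c; rewrite glueD in cD.
  by rewrite (w_uniq v) // (contra (subsetP (ST i) v) cD).
(* Remaining case: [u] is super dominated by the root of its graph. As [u] was not added to [T i],
   the index is [i0]; then every other [U j] was absorbed, and [u] is the only neighbour of the root
   outside [D]. *)
subst w; have Ui : U i = [set u].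
  apply/setP => v; rewrite !inE; apply/andP/eqP => [[vS xv]|->//].
  exact: w_uniq.
have ii0 : i = i0.
  by apply: contraNeq bD => ii0; rewrite /T ii0 Ui cards1 !inE eqxx orbT.
have allU : [forall i, #|U i| == 1].
  by apply: (implyP i0P); rewrite -ii0 Ui cards1.
rewrite glue_root => /adj_glue_root[j [v cv xv]]; subst c; rewrite glueD in cD.
have vU : v \in U j by rewrite !inE xv (contra (subsetP (ST j) v) cD).
have ji0 : j = i0.
  by apply: contraNeq cD => ji0; rewrite /T ji0 (forallP allU) inE vU orbT.
by subst; rewrite Ui inE in vU; rewrite (eqP vU).
Qed.

End BouquetProjection.

Local Open Scope ring_scope.

Theorem corollary4p3 (n : nat) (G : 'I_n -> sgraph) (x : forall i : 'I_n, G i)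
    (n_gt0 : (0 < n)%N) (G_conn : forall i : 'I_n, connected_graph (G i)) :
  (\sum_(i < n) (gamma_sp (G i))%:Z) - n%:Z + 1 <= (gamma_sp (bouquet x))%:Z
  /\ (gamma_sp (bouquet x))%:Z <= \sum_(i < n) (gamma_sp (G i))%:Z.
Proof.
have -> : \sum_(i < n) (gamma_sp (G i))%:Z = (\sum_(i < n) gamma_sp (G i))%N%:Z.
  by rewrite (big_morph Posz PoszD erefl).
have := bouquet_le_sum_gamma x n_gt0.
have [[D sdD <-] _] := gamma_spP (bouquet x).
by have := sum_gamma_le_bouquet sdD; lia.
Qed.
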